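(* For all sequences $\overline{x},\overline{y},\overline{z}\in\mathsf{seq}$: if $\overline{x}\rightsquigarrow\overline{y}$, $\overline{x}\rightsquigarrow\overline{z}$, and both $\overline{y}$ and $\overline{z}$ are reduced, then $\overline{y}=\overline{z}$.
   Context: $\mathsf{seq}$ is the set of finite sequences over the alphabet $\{l,r,\lambda,\rho,n\}$, with juxtaposition denoting concatenation. One-step reduction $\rightsquigarrow'$ is the relation generated by the rules (for arbitrary $\overline{x},\overline{y}\in\mathsf{seq}$): $\overline{x}l\lambda\overline{y}\rightsquigarrow'\overline{x}\rho\overline{y}$; $\overline{x}r\lambda\overline{y}\rightsquigarrow'\overline{x}\overline{y}$; $\overline{x}\lambda r\overline{y}\rightsquigarrow'\overline{x}\overline{y}$; $\overline{x}\rho r\overline{y}\rightsquigarrow'\overline{x}l\overline{y}$; $\overline{x}nn\overline{y}\rightsquigarrow'\overline{x}\overline{y}$. A sequence is reduced if no one-step reduction applies to it. $\overline{x}\rightsquigarrow\overline{y}$ means $\overline{y}$ is obtained from $\overline{x}$ by a finite chain of one-step reductions. *)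

(* Defs.v *)
From Stdlib Require Export List Relations.
Export ListNotations.

Inductive letter : Type := l | r | lambda | rho | n.

Definition word : Type := list letter.

Inductive step : word -> word -> Prop :=
| step_l_lambda (x y : word) : step (x ++ [l; lambda] ++ y) (x ++ [rho] ++ y)
| step_r_lambda (x y : word) : step (x ++ [r; lambda] ++ y) (x ++ y)
| step_lambda_r (x y : word) : step (x ++ [lambda; r] ++ y) (x ++ y)
| step_rho_r (x y : word) : step (x ++ [rho; r] ++ y) (x ++ [l] ++ y)
| step_n_n (x y : word) : step (x ++ [n; n] ++ y) (x ++ y).

Definition reduced (x : word) : Prop := ~ exists y : word, step x y.

(* Chains may be empty, so every word reduces to itself. *)
Definition reduces : word -> word -> Prop := clos_refl_trans word step.

(* Main.v *)
Require Import Defs.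

(** Prepending a letter to an irreducible word and contracting the redex this may
    create, if any, gives an irreducible word again. Folding this operation over a
    word computes a normal form which every one-step reduction preserves (the checks
    for the five rules are the critical pairs) and which is the word itself when the
    word is reduced. *)

Definition redex (a b : letter) : bool :=
  match a, b with
  | l, lambda | r, lambda | lambda, r | rho, r | n, n => true
  | _, _ => false
  end.

Fixpoint irreducible (w : word) : bool :=
  match w with
  | a :: (b :: _) as t => negb (redex a b) && irreducible t
  | _ => true
  end.

Definition prepend (a : letter) (w : word) : word :=
  match a, w with
  | l, lambda :: t => rho :: t
  | r, lambda :: t => t
  | lambda, r :: t => t
  | rho, r :: t => l :: t
  | n, n :: t => t
  | _, _ => a :: w
  end.

Definition normal_form (w : word) : word := fold_right prepend [] w.

(** A contraction at most replaces a head [lambda] by [rho] or [r] by [l]; the new head forms a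
    redex only with a letter with which the old one already did. *)
Lemma irreducible_prepend (a : letter) (w : word) :
  irreducible w = true -> irreducible (prepend a w) = true.
Proof.
  destruct w as [|b [|c t]]; destruct a; try destruct b; try destruct c;
    simpl; congruence.
Qed.

Lemma irreducible_normal_form (w : word) : irreducible (normal_form w) = true.
Proof.
  induction w as [|a w IH]; [reflexivity | now apply irreducible_prepend].
Qed.

(** If the inner [prepend] cancels the head of [w], irreducibility keeps the next letter from
    reacting with the outer one. *)
Lemma prepend_rules (w : word) :
  irreducible w = true ->
  prepend l (prepend lambda w) = prepend rho w /\
  prepend r (prepend lambda w) = w /\
  prepend lambda (prepend r w) = w /\
  prepend rho (prepend r w) = prepend l w /\
  prepend n (prepend n w) = w.
Proof.
  destruct w as [|a [|b t]]; try destruct a; try destruct b;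
    simpl; intuition congruence.
Qed.

Lemma step_normal_form (x y : word) : step x y -> normal_form x = normal_form y.
Proof.
  unfold normal_form.
  (* The prefix [u] is folded last, so comparing the accumulators it starts from suffices. *)
  intros [u v|u v|u v|u v|u v]; rewrite !fold_right_app; f_equal;
    apply (prepend_rules _ (irreducible_normal_form v)).
Qed.

Lemma reduces_normal_form (x y : word) :
  reduces x y -> normal_form x = normal_form y.
Proof.
  induction 1; [now apply step_normal_form | reflexivity | congruence].
Qed.

Lemma step_cons (a : letter) (x y : word) : step x y -> step (a :: x) (a :: y).
Proof.
  intros [u v|u v|u v|u v|u v]; rewrite !app_comm_cons; constructor.
Qed.

Lemma prepend_reduced (a : letter) (w : word) :
  reduced (a :: w) -> prepend a w = a :: w.
Proof.
  intros H.
  destruct w as [|b t]; destruct a; try destruct b; try reflexivity;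
    destruct H; eexists.
  (* What remains are the five contracting cases, each a redex at the very front. *)
  - apply (step_l_lambda []).
  - apply (step_r_lambda []).
  - apply (step_lambda_r []).
  - apply (step_rho_r []).
  - apply (step_n_n []).
Qed.

Lemma normal_form_reduced (w : word) : reduced w -> normal_form w = w.
Proof.
  induction w as [|a w IH]; intros H; [reflexivity|].
  simpl; rewrite IH; [now apply prepend_reduced|].
  intros [y Hy]; apply H; exists (a :: y); now apply step_cons.
Qed.

Theorem theorem24 (x y z : word) :
  reduces x y -> reduces x z -> reduced y -> reduced z -> y = z.
Proof.
  intros Hxy Hxz Hy Hz.
  rewrite <- (normal_form_reduced y Hy), <- (normal_form_reduced z Hz).
  now rewrite <- (reduces_normal_form x y Hxy), <- (reduces_normal_form x z Hxz).
Qed.
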